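(* Fix a positive integer $n$, a nonzero $n$-partition $\lambda$ with $\lambda_n=0$, and an $n$-semistandard tableau $T$ of shape $\lambda$. Let $\pi_T$ be the final permutation produced by the greedy (alcove model) procedure applied to $T$, and let $\sigma_T$ be the permutation associated with the scanning tableau $S(T)$ of $T$ (both defined in the context). Then $\pi_T=\sigma_T$.
   Context: Let $\lambda=(\lambda_1,\dots,\lambda_n)$ be weakly decreasing nonnegative integers with $\lambda_n=0$, $\lambda\neq 0$, identified with its Young diagram ($\lambda_i$ left-justified boxes in row $i$). For $1\le j\le\lambda_1$ let $c_j$ be the length of column $j$. Let $\zeta_1<\dots<\zeta_d$ be the distinct column lengths, $\zeta_0:=0$, $\zeta_{d+1}:=n$. Write $(j,i)$ for the box in column $j$, row $i$ ($1\le i\le c_j$). Reading order: $(l,k)\le(j,i)$ iff $l<j$, or $l=j$ and $k\ge i$ (columns left to right, each column bottom to top). Convention: $(j,c_j+1)$ means $(j-1,1)$. An $n$-semistandard tableau $T$ of shape $\lambda$ is a filling with entries in $[n]=\{1,\dots,n\}$, weakly increasing along rows and strictly increasing down columns; $T(j,i)$ is its entry at $(j,i)$ and $C_j$ its $j$-th column. A key is a tableau in which every value of $C_j$ also appears in $C_{j-1}$ for $1<j\le\lambda_1$. Permutations in $S_n$ are written in one-line form $(\phi_1,\dots,\phi_n)$. $S_n^\lambda$ is the set of $\phi\in S_n$ with $\phi_{\zeta_{h-1}+1}<\dots<\phi_{\zeta_h}$ for $1\le h\le d+1$. Scanning tableau: The EWIS of a finite sequence $x_1,x_2,\dots$ is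 $x_{a_1},x_{a_2},\dots$ with $a_1=1$ and $a_b$ the smallest index $>a_{b-1}$ with $x_{a_b}\ge x_{a_{b-1}}$ (stopping when none exists). For each column $j$ and for $i=c_j,c_j-1,\dots,1$ in turn: delete from $T$ and $\lambda$ the boxes of the previously computed paths $P(T;j,k)$, $k>i$ (this leaves a semistandard tableau of a valid shape); form the sequence of entries in the lowest box of each of the columns $j,j+1,\dots,\lambda_1$ of the current shape (skipping empty columns); the scanning path $P(T;j,i)$ is the set of locations of the terms of its EWIS (its first location is $(j,i)$). The scanning tableau $S(T)$ has shape $\lambda$ and entry at $(j,i)$ equal to $T$ at the last location (in reading order) of $P(T;j,i)$; $S(T)$ is a key. Define $\sigma_T$ by: for $1\le h\le d$, $\sigma_{\zeta_{h-1}+1},\dots,\sigma_{\zeta_h}$ are the values in the columns of length $\zeta_h$ of $S(T)$ that are not in the columns of length $\zeta_{h-1}$ (all values for $h=1$), in increasing order; and $\sigma_{\zeta_d+1},\dots,\sigma_n$ are the values of $[n]$ not in the first column of $S(T)$, in increasing order. Greedy procedure: $\pi^{(1,1)}$ has as first $c_1$ entries the entries of $C_1$ in increasing order, followed by the remaining elements of $[n]$ in increasing order. For locations $(j,i)$ with $j\ge 2$, taken in reading order from $(2,c_2)$ to $(\lambda_1,1)$, define $\pi^{(j,i)}$ from its predecessor $\pi:=\pi^{(j,i+1)}$. If $T(j-1,i)=T(j,i)$, set $\pi^{(j,i)}=\pi$. Otherwise (then $\pi_i=T(j-1,i)$ and $T(j,i)=\pi_k$ for some $k>c_j$): let $i_0=i$;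 given $i_{x-1}$ with $\pi_{i_{x-1}}<T(j,i)$, let $i_x$ be the smallest index $>c_j$ with $\pi_{i_{x-1}}<\pi_{i_x}\le T(j,i)$; stop at $i_m$ with $\pi_{i_m}=T(j,i)$. Set $\pi^{(j,i)}_{i_x}=\pi_{i_{x-1}}$ for $1\le x\le m$, $\pi^{(j,i)}_{i_0}=\pi_{i_m}$, and all other entries equal to those of $\pi$. Finally $\pi_T:=\pi^{(\lambda_1,1)}$. *)

(* Defs.v *)
From mathcomp Require Import all_boot.

Set Implicit Arguments.
Unset Strict Implicit.
Unset Printing Implicit Defensive.

(* A partition lam = (lam_1,...,lam_n) is a seq nat of size n (row lengths).
   Tableaux are functions T : nat -> nat -> nat, with T j i the entry in
   column j, row i (both 1-indexed), as in the paper's notation T(j,i).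
   Permutations are one-line words (phi_1,...,phi_n) : seq nat. *)

Definition is_partition (n : nat) (lam : seq nat) : Prop :=
  [/\ size lam = n, sorted geq lam, nth 0 lam n.-1 = 0 & has (fun x => 0 < x) lam].

Definition lam1 (lam : seq nat) : nat := head 0 lam.

Definition colLen (lam : seq nat) (j : nat) : nat := count (fun r => j <= r) lam.

Definition in_shape (lam : seq nat) (j i : nat) : bool :=
  [&& 1 <= j, 1 <= i & i <= colLen lam j].

Definition semistandard (n : nat) (lam : seq nat) (T : nat -> nat -> nat) : Prop :=
  forall j i, in_shape lam j i ->
    [/\ 1 <= T j i <= n,
        (in_shape lam j.+1 i -> T j i <= T j.+1 i) &
        (in_shape lam j i.+1 -> T j i < T j i.+1)].

(* The current shape (after deleting earlier scanning paths, which     *)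
(* always remove the lowest box of each column they visit) is recorded *)
(* by the current column lengths h : nat -> nat.  The lowest box of    *)
(* column l of the current shape is (l, h l); empty columns (h l = 0)  *)
(* are skipped.                                                        *)

Fixpoint scan_sel (T : nat -> nat -> nat) (h : nat -> nat) (cur : nat)
    (cols : seq nat) : seq nat :=
  match cols with
  | [::] => [::]
  | l :: cols' =>
      if (0 < h l) && (cur <= T l (h l))
      then l :: scan_sel T h (T l (h l)) cols'
      else scan_sel T h cur cols'
  end.

(* columns (other than j) visited by the scanning path P(T;j,i), given the
   current column lengths h; its first location is (j,i) *)
Definition path_tail (lam : seq nat) (T : nat -> nat -> nat) (h : nat -> nat)
    (j i : nat) : seq nat :=
  scan_sel T h (T j i) (iota j.+1 (lam1 lam - j)).

Definition delete_path (lam : seq nat) (T : nat -> nat -> nat) (h : nat -> nat)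
    (j i : nat) : nat -> nat :=
  fun l => if l \in j :: path_tail lam T h j i then (h l).-1 else h l.

(* column lengths after the paths P(T;j,k), for k = c_j, ..., c_j - m + 1,
   have been deleted *)
Fixpoint scan_shape (lam : seq nat) (T : nat -> nat -> nat) (j m : nat)
    : nat -> nat :=
  match m with
  | 0 => colLen lam
  | m'.+1 => delete_path lam T (scan_shape lam T j m') j (colLen lam j - m')
  end.

Definition scanT (lam : seq nat) (T : nat -> nat -> nat) (j i : nat) : nat :=
  let h := scan_shape lam T j (colLen lam j - i) in
  last (T j i) [seq T l (h l) | l <- path_tail lam T h j i].

Definition zetas (lam : seq nat) : seq nat :=
  sort leq (undup [seq colLen lam j | j <- iota 1 (lam1 lam)]).

Definition in_cols_of_len (lam : seq nat) (S : nat -> nat -> nat) (z v : nat)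
    : bool :=
  has (fun l => (colLen lam l == z) && has (fun r => S l r == v) (iota 1 (colLen lam l)))
      (iota 1 (lam1 lam)).

Definition sigma_perm (n : nat) (lam : seq nat) (T : nat -> nat -> nat) : seq nat :=
  let S := scanT lam T in
  let zs := zetas lam in
  flatten [seq [seq v <- iota 1 n |
                  in_cols_of_len lam S (nth 0 zs h) v &&
                  ~~ in_cols_of_len lam S (if h is h'.+1 then nth 0 zs h' else 0) v]
          | h <- iota 0 (size zs)]
  ++ [seq v <- iota 1 n | ~~ has (fun r => S 1 r == v) (iota 1 (colLen lam 1))].

Definition pent (p : seq nat) (k : nat) : nat := nth 0 p k.-1.

Fixpoint greedy_chain (p : seq nat) (cj t prev fuel : nat) : seq nat :=
  match fuel with
  | 0 => [::]
  | fuel'.+1 =>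
      if pent p prev < t then
        match [seq k <- iota cj.+1 (size p - cj) |
                 (pent p prev < pent p k) && (pent p k <= t)] with
        | [::] => [::]
        | k :: _ => k :: greedy_chain p cj t k fuel'
        end
      else [::]
  end.

Definition greedy_step (lam : seq nat) (T : nat -> nat -> nat) (p : seq nat)
    (loc : nat * nat) : seq nat :=
  let: (j, i) := loc in
  if T j.-1 i == T j i then p else
  let ch := greedy_chain p (colLen lam j) (T j i) i (size p) in
  let I := i :: ch in
  [seq (if k \in I then
          (if index k I is x.+1 then pent p (nth 0 I x) else pent p (last i ch))
        else pent p k) | k <- iota 1 (size p)].

Definition greedy_init (n : nat) (lam : seq nat) (T : nat -> nat -> nat) : seq nat :=
  let C1 := [seq T 1 r | r <- iota 1 (colLen lam 1)] in
  C1 ++ [seq v <- iota 1 n | v \notin C1].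

Definition greedy_locs (lam : seq nat) : seq (nat * nat) :=
  flatten [seq [seq (j, i) | i <- rev (iota 1 (colLen lam j))]
          | j <- iota 2 (lam1 lam).-1].

Definition greedy_perm (n : nat) (lam : seq nat) (T : nat -> nat -> nat) : seq nat :=
  foldl (greedy_step lam T) (greedy_init n lam T) (greedy_locs lam).

(* Main.v *)
Require Import Defs.
From mathcomp Require Import all_boot zify.

Set Implicit Arguments.
Unset Strict Implicit.
Unset Printing Implicit Defensive.

(* Both procedures, read column by column, perform the same local operation on
   words. A greedy step at (j, i) bubbles the old entry T(j-1, i) through the
   letters of the permutation beyond position c_j, and t = T(j, i) comes out.
   Truncated to any prefix of length z >= c_j, the net effect on the set of
   letters is that the largest letter <= t leaves and t enters. Letting all
   scanning paths that start in a fixed column l traverse column j at once has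
   the same effect: from bottom to top, the entry t of column j replaces the
   largest path end <= t not yet extended. Hence, by induction on the number of
   columns, the ends of the paths from column l are the first c_l letters of the
   permutation. Since bubbling never destroys an ascent beyond position c_j, the
   final permutation increases between consecutive column lengths, and so it is
   determined by its prefix sets of lengths zeta_h. *)

(** * Bubbling a letter through a word *)

Fixpoint bubble (t a : nat) (q : seq nat) : seq nat :=
  if q is y :: q' then
    if (a < y) && (y <= t) then a :: bubble t y q' else y :: bubble t a q'
  else [::].

(* The letter left in hand when [bubble t a q] reaches the end of [q]. *)
Fixpoint carry (t a : nat) (q : seq nat) : nat :=
  if q is y :: q' then
    if (a < y) && (y <= t) then carry t y q' else carry t a q'
  else a.

Lemma take_bubble z t a q : take z (bubble t a q) = bubble t a (take z q).
Proof.
elim: q a z => [|y q IH] a [|z] //=; case: ifP => _ //=; by rewrite IH.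
Qed.

Lemma perm_bubble t a q : perm_eq (carry t a q :: bubble t a q) (a :: q).
Proof.
elim: q a => //= y q IH a; apply/permP => P.
by case: ifP => _; [have /permP/(_ P) := IH y | have /permP/(_ P) := IH a];
  rewrite /=; lia.
Qed.

Lemma carry_le t a q : a <= t -> carry t a q <= t.
Proof.
elim: q a => //= y q IH a le_at; case: ifP => [/andP[_ le_yt]|_]; exact: IH.
Qed.

Lemma carry_ge_start t a q : a <= carry t a q.
Proof.
elim: q a => //= y q IH a; case: ifP => [/andP[/ltnW le_ay _]|_] //.
exact: leq_trans (IH y).
Qed.

(** With [carry_le] and [perm_bubble]: for [a <= t], the expelled letter is the largest one [<= t]
    in [a :: q]. The letter in hand never decreases, and every letter [<= t] that is met is picked
    up or is at most the one in hand. *)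
Lemma carry_ge t a q y : y \in a :: q -> y <= t -> y <= carry t a q.
Proof.
rewrite inE => /predU1P[->|]; first by rewrite carry_ge_start.
elim: q a => [|z q IH] a //=; rewrite inE => /predU1P[->|yq] le_yt.
  have := carry_ge_start t a q; have := carry_ge_start t z q.
  by case: ifP; lia.
by case: ifP => _; apply: IH.
Qed.

Lemma carry_eq t a q : a <= t -> t \in a :: q -> carry t a q = t.
Proof.
by move=> le_at tq; apply/eqP; rewrite eqn_leq carry_le // carry_ge.
Qed.

(** Letters at a position only get smaller, so the danger is that the second letter is displaced. If
    the first was displaced just before, it moves one place right, behind a smaller letter. If not,
    it is [<= t] too, hence below the letter in hand, distinctness excluding equality. *)
Lemma bubble_ascent t a q k : uniq (a :: q) -> k.+1 < size q ->
  nth 0 q k < nth 0 q k.+1 ->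
  nth 0 (bubble t a q) k < nth 0 (bubble t a q) k.+1.
Proof.
elim: q a k => [|y q IH] a [|k] //=.
  case: q IH => [|z q] //= _; rewrite !inE => /and3P[].
  by do 2?case: ifP => //=; lia.
rewrite !inE => /and3P[/norP[_ aq] yq uq] lt_k lt_nth.
by case: ifP => _ /=; apply: IH; rewrite //= ?aq ?yq.
Qed.

(** * A greedy step is one bubbling *)

Fixpoint record_positions (t a : nat) (q : seq nat) (k : nat) : seq nat :=
  if q is y :: q' then
    if (a < y) && (y <= t) then k :: record_positions t y q' k.+1
    else record_positions t a q' k.+1
  else [::].

Lemma record_positions_ge t a q k x : x \in record_positions t a q k -> k <= x.
Proof.
elim: q a k => //= y q IH a k; case: ifP => _; last by move/IH/ltnW.
by rewrite inE => /orP[/eqP->|/IH/ltnW].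
Qed.

(** [greedy_chain] restarts each search at [c.+1], while bubbling only moves right. They agree
    because the letter in hand grows: a letter once rejected stays rejected. The last hypothesis
    records this for the positions up to [r]. *)
Lemma greedy_chainE p c t prev fuel r :
  c <= r <= size p -> size p - r <= fuel ->
  (forall k, c < k <= r -> ~~ ((pent p prev < pent p k) && (pent p k <= t))) ->
  greedy_chain p c t prev fuel =
    record_positions t (pent p prev) (drop r p) r.+1.
Proof.
move Ed: (size p - r) => d.
elim: d r prev fuel Ed => [|d IH] r prev fuel Ed Hr Hf Hno.
  rewrite drop_oversize; last lia.
  case: fuel Hf => //= fuel _; case: ifP => // _.
  rewrite (@eq_in_filter _ _ pred0) ?filter_pred0 // => k.
  by rewrite mem_iota => Hk; apply/negbTE/Hno; lia.
rewrite (drop_nth 0) /=; last lia.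
have -> : nth 0 p r = pent p r.+1 by [].
case: ifP => [Hq|Hq].
  case: fuel Hf => [|fuel] Hf /=; first lia.
  case: ifP => [_|]; last lia.
  have -> : size p - c = (r - c) + (size p - r) by lia.
  rewrite iotaD filter_cat (@eq_in_filter _ _ pred0) ?filter_pred0; last first.
    move=> k; rewrite mem_iota => Hk; apply/negbTE/Hno; lia.
  have -> : c.+1 + (r - c) = r.+1 by lia.
  rewrite Ed /= Hq (IH r.+1) //; try lia.
  move=> k Hk; have [->|nk] := eqVneq k r.+1; first lia.
  by have := Hno k; lia.
rewrite (IH r.+1) //; try lia.
move=> k Hk; have [->|nk] := eqVneq k r.+1; first by rewrite Hq.
by apply: Hno; lia.
Qed.

Definition shift_along (p : seq nat) (prev : nat) (ch : seq nat) (k : nat) :=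
  if k \in ch then pent p (nth 0 (prev :: ch) (index k ch)) else pent p k.

Lemma shift_along_bubble p t prev r :
  r <= size p ->
  [seq shift_along p prev (record_positions t (pent p prev) (drop r p) r.+1) k
     | k <- iota r.+1 (size p - r)] = bubble t (pent p prev) (drop r p).
Proof.
move Ed: (size p - r) => d.
elim: d r prev Ed => [|d IH] r prev Ed Hr.
  by rewrite drop_oversize //; lia.
rewrite (drop_nth 0) /=; last lia.
have -> : nth 0 p r = pent p r.+1 by [].
have Hnin a : (r.+1 \in record_positions t a (drop r.+1 p) r.+2) = false.
  by apply/negP => /record_positions_ge; rewrite ltnn.
case: ifP => Hq.
  rewrite /shift_along mem_head /= eqxx; congr (_ :: _).
  rewrite -IH; try lia; apply/eq_in_map => k; rewrite mem_iota => Hk.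
  have nk : k != r.+1 by lia.
  by rewrite /shift_along inE (negbTE nk) /= eq_sym (negbTE nk).
rewrite {1}/shift_along Hnin; congr (_ :: _).
by rewrite -IH //; lia.
Qed.

Lemma last_record_positions p t prev r :
  r <= size p ->
  pent p (last prev (record_positions t (pent p prev) (drop r p) r.+1))
    = carry t (pent p prev) (drop r p).
Proof.
move Ed: (size p - r) => d.
elim: d r prev Ed => [|d IH] r prev Ed Hr.
  by rewrite drop_oversize //; lia.
rewrite (drop_nth 0) /=; last lia.
have -> : nth 0 p r = pent p r.+1 by [].
by case: ifP => _; rewrite /= -IH //; lia.
Qed.

Lemma greedy_stepE lam T p j i :
  0 < i <= colLen lam j -> colLen lam j <= size p ->
  pent p i = T j.-1 i -> T j.-1 i <= T j i ->
  T j i \in T j.-1 i :: drop (colLen lam j) p ->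
  greedy_step lam T p (j, i) =
    set_nth 0 (take (colLen lam j) p) i.-1 (T j i)
      ++ bubble (T j i) (T j.-1 i) (drop (colLen lam j) p).
Proof.
set c := colLen lam j; set t := T j i => Hi Hc Epi le_at tq.
rewrite /greedy_step -/t -/c (@greedy_chainE _ _ _ _ _ c); try lia.
set ch := record_positions _ _ _ _.
have ch_gt k : k \in ch -> c < k by move/record_positions_ge.
have Elast : pent p (last i ch) = t.
  by rewrite last_record_positions // Epi carry_eq.
have Hset : [seq if k == i then t else pent p k | k <- iota 1 c]
    = set_nth 0 (take c p) i.-1 t.
  apply: (@eq_from_nth _ 0).
    by rewrite size_map size_iota size_set_nth size_takel //; lia.
  move=> k; rewrite size_map size_iota => Hk.
  rewrite (nth_map 0) ?size_iota // nth_iota // nth_set_nth /= add1n.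
  have -> : (k.+1 == i) = (k == i.-1) by lia.
  by rewrite nth_take.
case: ifP => [/eqP Eat|nat].
  (* A step that leaves [p] alone fits the formula: no letter satisfies [t < y <= t]. *)
  have -> : bubble t (T j.-1 i) (drop c p) = drop c p.
    rewrite Eat; elim: (drop c p) => //= y q IH.
    by case: ifP => [|_]; [lia | rewrite IH].
  rewrite -[LHS](cat_take_drop c); congr (_ ++ _).
  rewrite -Hset; apply: (@eq_from_nth _ 0).
    by rewrite size_map size_iota size_takel.
  move=> k; rewrite size_takel // => Hk.
  rewrite (nth_map 0) ?size_iota // nth_iota // nth_take // add1n.
  by case: eqP => // Ek; rewrite -Eat -Epi -Ek.
have {1}-> : size p = c + (size p - c) by lia.
rewrite iotaD map_cat add1n; congr (_ ++ _).
  rewrite -Hset; apply/eq_in_map => k; rewrite mem_iota => Hk.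
  rewrite inE /=; case: (eqVneq k i) => [->|ki]; first by rewrite Elast.
  by case: ifP => //= /ch_gt; lia.
rewrite -Epi -shift_along_bubble //; apply/eq_in_map => k.
rewrite mem_iota => Hk; have ki : k != i by lia.
by rewrite inE (negbTE ki) /= eq_sym (negbTE ki).
Qed.

(** * Scanning paths crossing one column *)

Lemma gtn_trans : transitive gtn.
Proof. by move=> u v w /=; lia. Qed.

(* One column with entries [b 1 < ... < b h] traversed by the current ends [s] of
   the scanning paths, in the order in which the paths are computed. *)
Fixpoint colscan (b : nat -> nat) (h : nat) (s : seq nat) : seq nat :=
  if s is x :: s' then
    if (0 < h) && (x <= b h) then b h :: colscan b h.-1 s'
    else x :: colscan b h s'
  else [::].

Lemma colscan_step b h s x :
  sorted gtn s -> x \in s -> x <= b h.+1 ->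
  (forall y, y \in s -> y <= b h.+1 -> y <= x) ->
  (0 < h -> b h < b h.+1) ->
  perm_eq (colscan b h.+1 s) (b h.+1 :: colscan b h (rem x s)).
Proof.
elim: s => //= y s IH Hs xs le_xb max_x lt_b.
have /allP ys : all (gtn y) s := order_path_min gtn_trans Hs.
have [le_yb|lt_by] := leqP y (b h.+1).
  have le_yx : y <= x by apply: max_x; rewrite ?mem_head.
  suff -> : y = x by rewrite eqxx.
  by move: xs; rewrite inE => /predU1P[//|/ys /=]; lia.
have nyx : y != x by lia.
rewrite (negbTE nyx) /=.
have -> : (0 < h) && (y <= b h) = false by lia.
have xs' : x \in s by move: xs; rewrite inE eq_sym (negbTE nyx).
have max_x' z : z \in s -> z <= b h.+1 -> z <= x.
  by move=> zs; apply: max_x; rewrite inE zs orbT.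
apply/permP => P.
have /permP/(_ P) := IH (path_sorted Hs) xs' le_xb max_x' lt_b.
by rewrite /=; lia.
Qed.

Lemma colscan_path b h z s :
  (forall r, 0 < r < h -> b r < b r.+1) -> (0 < h -> b h < z) ->
  path gtn z s -> path gtn z (colscan b h s).
Proof.
elim: s h z => //= x s IH h z Hb Hz /andP[lt_xz Hs].
case: ifP => [/andP[h0 le_xb]|Hn] /=.
  rewrite Hz //=; apply: IH => [r Hr|h1|]; first by apply: Hb; lia.
    by have := Hb h.-1; rewrite prednK //; apply; lia.
  by case: s Hs => //= y s /andP[lt_yx ->]; rewrite andbT; lia.
by rewrite lt_xz; apply: IH => // h0; lia.
Qed.

Lemma colscan_sorted b h s :
  (forall r, 0 < r < h -> b r < b r.+1) ->
  sorted gtn s -> sorted gtn (colscan b h s).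
Proof.
move=> Hb; case: s => //= x s Hs.
(* Any value above both [x] and the lowest entry can serve as the head for [colscan_path]. *)
apply: (path_sorted (x := (maxn (b h) x).+1)).
rewrite -[if _ then _ else _]/(colscan b h (x :: s)).
apply: colscan_path => //=; first lia.
by rewrite Hs andbT; lia.
Qed.

Lemma set_nth_cat_size (A B : seq nat) x y :
  set_nth 0 (A ++ x :: B) (size A) y = A ++ y :: B.
Proof. by elim: A => //= z A ->. Qed.

Arguments greedy_step : simpl never.

(** Induction on the number [i] of rows still to do, bottom row first: below row [i] the prefix
    already shows column [j], above it still column [j.-1]. In the last clause [s] holds the path
    ends still to meet these rows; the cut [z] is arbitrary so that one statement serves every
    starting column. *)
Lemma greedy_column n lam T j i p :
  i <= colLen lam j ->
  (forall r, 0 < r <= colLen lam j -> T j.-1 r <= T j r) ->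
  (forall r r', 0 < r -> r < r' <= colLen lam j -> T j.-1 r < T j.-1 r') ->
  (forall r r', 0 < r -> r < r' <= colLen lam j -> T j r < T j r') ->
  (forall r, 0 < r <= colLen lam j -> 1 <= T j r <= n) ->
  perm_eq p (iota 1 n) ->
  take (colLen lam j) p =
    [seq T j.-1 r | r <- iota 1 i] ++
    [seq T j r | r <- iota i.+1 (colLen lam j - i)] ->
  let p' := foldl (greedy_step lam T) p [seq (j, r) | r <- rev (iota 1 i)] in
  [/\ perm_eq p' (iota 1 n),
      take (colLen lam j) p' = [seq T j r | r <- iota 1 (colLen lam j)],
      forall k, colLen lam j <= k -> k.+1 < n ->
        nth 0 p k < nth 0 p k.+1 -> nth 0 p' k < nth 0 p' k.+1
    & forall z s, sorted gtn s ->
        perm_eq s (take i p ++ take z (drop (colLen lam j) p)) ->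
        perm_eq (colscan (T j) i s)
          ([seq T j r | r <- iota 1 i] ++ take z (drop (colLen lam j) p'))].
Proof.
set c := colLen lam j => Hi Hrow Hprev Hcol Hrg.
elim: i p Hi => [|i IH] p Hi Hp Etake.
  split=> // [|z s _ Hs]; first by rewrite Etake subn0.
  suff -> : colscan (T j) 0 s = s by move: Hs; rewrite take0.
  by elim: {Hs} s => //= x s ->.
set a := T j.-1 i.+1; set t := T j i.+1.
set A := [seq T j.-1 r | r <- iota 1 i].
set B := [seq T j r | r <- iota i.+2 (c - i.+1)].
have szA : size A = i by rewrite size_map size_iota.
have {}Etake : take c p = A ++ a :: B.
  by rewrite Etake -/B -(addn1 i) iotaD map_cat -catA /= add1n.
have szp : size p = n by rewrite (perm_size Hp) size_iota.
have Hup : uniq p by rewrite (perm_uniq Hp) iota_uniq.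
have szt : size (take c p) = c.
  by rewrite Etake size_cat szA /= size_map size_iota; lia.
have Hc : c <= size p by move: szt; rewrite size_take; case: ltnP; lia.
set q := drop c p.
have Ep : p = (A ++ a :: B) ++ q by rewrite -Etake cat_take_drop.
have le_at : a <= t by apply: Hrow; lia.
have ltA y : y \in A -> y < a.
  by case/mapP=> r; rewrite mem_iota => Hr ->; apply: Hprev; lia.
(* [t] occurs in [p], but the letters of [A] are smaller than [a], and those of [B], lower in column
   [j], exceed [t]. *)
have tq : t \in a :: q.
  have : t \in p.
    by rewrite (perm_mem Hp) mem_iota; have := Hrg i.+1; rewrite -/t; lia.
  rewrite Ep !mem_cat !inE -!orbA => /or4P[/ltA|->|/mapP[r]|->] //; first lia.
    rewrite mem_iota => Hr Er; have := Hcol i.+1 r isT; rewrite -Er -/t; lia.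
  by rewrite orbT.
have Epi : pent p i.+1 = a by rewrite /pent Ep /= -catA nth_cat szA ltnn subnn.
have Ecarry : carry t a q = t by exact: carry_eq.
rewrite -[in rev _](addn1 i) iotaD rev_cat /= add1n.
set p1 := greedy_step lam T p (j, i.+1).
have Ep1 : p1 = (A ++ t :: B) ++ bubble t a q.
  rewrite /p1 greedy_stepE //; try lia.
  by rewrite -/c Etake -/t /= -{1}szA set_nth_cat_size.
have Hp1 : perm_eq p1 (iota 1 n).
  rewrite -(permPr Hp) Ep1 Ep; apply/permP => P.
  have /permP/(_ P) := perm_bubble t a q; rewrite Ecarry !count_cat /=; clear; lia.
have szAB x : size (A ++ x :: B) = c by rewrite -szt Etake !size_cat.
have Et1 : take c p1 = A ++ t :: B by rewrite Ep1 -(szAB t) take_size_cat.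
have Ed1 : drop c p1 = bubble t a q by rewrite Ep1 -(szAB t) drop_size_cat.
have := IH p1 (ltnW Hi) Hp1.
have -> : c - i = (c - i.+1).+1 by lia.
case/(_ Et1) => [Hp' Htp' Hasc Hscan]; split=> // [k le_ck lt_kn lt_nth|z s Hs Hps].
  apply: Hasc => //; rewrite Ep1 !nth_cat !szAB.
  move: lt_nth; rewrite {1 2}Ep !nth_cat !szAB.
  have -> : k < c = false by lia. have -> : k.+1 < c = false by lia.
  have -> : k.+1 - c = (k - c).+1 by lia.
  move=> lt_nth; apply: bubble_ascent => //.
    move: Hup; rewrite Ep -catA cat_uniq => /and3P[_ _] /=.
    by rewrite mem_cat negb_or cat_uniq => /andP[/andP[_ ->] /and3P[]].
  by rewrite size_drop szp; lia.
(* All of [q] expels [t], but its prefix of length [z] expels [x], possibly smaller: this is the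
   path end that row [i.+1] of column [j] extends. *)
set x := carry t a (take z q).
have Eti : take i.+1 p = rcons A a.
  by rewrite Ep -cat_rcons -catA take_size_cat // size_rcons szA.
have Eti1 : take i p1 = A by rewrite Ep1 -catA take_size_cat.
have Hps' : perm_eq s (A ++ a :: take z q).
  by rewrite -cat_rcons -Eti.
have xin : x \in a :: take z q.
  by rewrite -(perm_mem (perm_bubble t a _)) mem_head.
have xs : x \in s by rewrite (perm_mem Hps') mem_cat xin orbT.
have Hrem : perm_eq (rem x s) (take i p1 ++ take z (drop c p1)).
  rewrite Eti1 Ed1 take_bubble; apply/permP => P.
  have /permP/(_ P) := perm_bubble t a (take z q).
  have /permP/(_ P) := perm_to_rem xs; have /permP/(_ P) := Hps'.
  by rewrite !count_cat /= -/x; clear; lia.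
have Hrs : sorted gtn (rem x s) by exact: subseq_sorted gtn_trans _ _ (rem_subseq _ _) Hs.
have Hstep : perm_eq (colscan (T j) i.+1 s) (t :: colscan (T j) i (rem x s)).
  apply: colscan_step => // [|y|i0]; first exact: carry_le.
    rewrite (perm_mem Hps') mem_cat => /orP[/ltA lt_ya _|]; last exact: carry_ge.
    exact: leq_trans (ltnW lt_ya) (carry_ge_start _ _ _).
  by apply: Hcol; rewrite ?i0 ?ltnSn.
have Emap : [seq T j r | r <- iota 1 i.+1] = rcons [seq T j r | r <- iota 1 i] t.
  by rewrite -(addn1 i) iotaD map_cat cats1 add1n.
have {}Hscan := Hscan z _ Hrs Hrem.
rewrite (permPl Hstep); apply/permP => P; have /permP/(_ P) := Hscan.
by have := congr1 (count P) Emap; rewrite -cats1 /= !count_cat /=; clear; lia.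
Qed.

(** * Following the scanning paths column by column *)

(* The end, within columns up to [l], of the scanning path P(T; j, c_j - m). *)
Definition path_value lam T j m l : nat :=
  let h := scan_shape lam T j m in
  let cur := T j (colLen lam j - m) in
  last cur [seq T x (h x) | x <- scan_sel T h cur (iota j.+1 (l - j))].

Lemma scan_sel_cat T h cur s1 s2 :
  scan_sel T h cur (s1 ++ s2) =
    scan_sel T h cur s1 ++
    scan_sel T h (last cur [seq T x (h x) | x <- scan_sel T h cur s1]) s2.
Proof. by elim: s1 cur => //= l s1 IH cur; case: ifP => _ /=; rewrite IH. Qed.

Lemma scan_sel_subset T h cur s : {subset scan_sel T h cur s <= s}.
Proof.
move=> x; elim: s cur => //= l s IH cur; rewrite inE.
by case: ifP => _; [rewrite inE => /predU1P[->|/IH->] | move/IH->];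
  rewrite ?eqxx ?orbT.
Qed.

(* Whether that path contains a box of column [l.+1]. *)
Definition taken lam T j m l : bool :=
  let h := scan_shape lam T j m in
  (0 < h l.+1) && (path_value lam T j m l <= T l.+1 (h l.+1)).

Lemma path_valueS lam T j m l : j <= l ->
  path_value lam T j m l.+1 =
    if taken lam T j m l then T l.+1 (scan_shape lam T j m l.+1)
    else path_value lam T j m l.
Proof.
move=> le_jl; rewrite /taken {1}/path_value.
have -> : l.+1 - j = (l - j) + 1 by lia.
have El : j.+1 + (l - j) = l.+1 by lia.
rewrite iotaD El scan_sel_cat map_cat last_cat.
rewrite -[last _ _ in X in last X]/(path_value lam T j m l) /=.
by case: ifP.
Qed.

(** [delete_path] runs through all columns, but whether it visits column [l.+1] is settled by the
    columns before; the pieces on either side contain only other columns. *)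
Lemma scan_shapeS lam T j m l : j <= l < lam1 lam ->
  scan_shape lam T j m.+1 l.+1 =
    if taken lam T j m l then (scan_shape lam T j m l.+1).-1
    else scan_shape lam T j m l.+1.
Proof.
move=> /andP[le_jl lt_l]; rewrite /= /delete_path.
congr (if _ then _ else _).
rewrite inE; have -> /= : l.+1 == j = false by lia.
rewrite /path_tail.
have -> : lam1 lam - j = (l - j) + (lam1 lam - l.+1).+1 by lia.
have El : j.+1 + (l - j) = l.+1 by lia.
rewrite iotaD El scan_sel_cat mem_cat.
rewrite [X in X || _](_ : _ = false); last first.
  by apply/negP => /scan_sel_subset; rewrite mem_iota; lia.
rewrite /= -/(path_value lam T j m l) -/(taken lam T j m l).
case: ifP => _; first by rewrite mem_head.
by apply/negP => /scan_sel_subset; rewrite mem_iota; lia.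
Qed.

Definition path_values lam T j l : seq nat :=
  [seq path_value lam T j m l | m <- iota 0 (colLen lam j)].

(** The definition completes one path before the next, whereas [colscan] sends all paths through one
    column. The order can be exchanged because, in column [l.+1], earlier paths affect a later one
    only through the height they leave. *)
Lemma path_valuesS lam T j l : j <= l < lam1 lam ->
  path_values lam T j l.+1 =
    colscan (T l.+1) (colLen lam l.+1) (path_values lam T j l).
Proof.
move=> Hl; rewrite /path_values -[colLen lam l.+1]/(scan_shape lam T j 0 l.+1).
elim: (colLen lam j) 0 => //= r IH m.
rewrite IH scan_shapeS // path_valueS; last by case/andP: Hl.
by rewrite -/(taken lam T j m l); case: ifP.
Qed.

Lemma path_values_start lam T j :
  path_values lam T j j = rev [seq T j r | r <- iota 1 (colLen lam j)].
Proof.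
apply: (@eq_from_nth _ 0); first by rewrite size_rev !size_map !size_iota.
move=> k; rewrite size_map size_iota => Hk.
rewrite (nth_map 0) ?size_iota // nth_iota // add0n.
rewrite nth_rev ?size_map ?size_iota // (nth_map 0) ?size_iota; last lia.
rewrite nth_iota; last lia.
by rewrite /path_value subnn /=; congr (T j _); lia.
Qed.

Lemma scanT_path_value lam T j i : i <= colLen lam j ->
  scanT lam T j i = path_value lam T j (colLen lam j - i) (lam1 lam).
Proof. by move=> Hi; rewrite /scanT /path_value /path_tail subKn. Qed.

Lemma has_scanT lam T j v :
  has (fun r => scanT lam T j r == v) (iota 1 (colLen lam j)) =
    (v \in path_values lam T j (lam1 lam)).
Proof.
apply/hasP/mapP => [[r]|[m]]; rewrite mem_iota => Hr.
  rewrite scanT_path_value; last lia.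
  move/eqP <-; exists (colLen lam j - r) => //; rewrite mem_iota; lia.
move=> ->; exists (colLen lam j - m); first by rewrite mem_iota; lia.
rewrite scanT_path_value; last lia.
by rewrite subKn //; lia.
Qed.

(** * Induction on the columns *)

Lemma colLen_mono lam j l : j <= l -> colLen lam l <= colLen lam j.
Proof. by move=> le_jl; apply: sub_count => r /=; exact: leq_trans. Qed.

Lemma semistandard_column n lam T j r r' : semistandard n lam T ->
  0 < j -> 0 < r -> r < r' <= colLen lam j -> T j r < T j r'.
Proof.
move=> HT j0 r0 /andP[]; elim: r' => // r' IH lt_rr' le_r'c.
have [] := HT j r'; first by rewrite /in_shape; lia.
move=> _ _ /(_ _)/wrap[]; first by rewrite /in_shape; lia.
have [->//|ne] := eqVneq r r'; apply: ltn_trans; apply: IH; lia.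
Qed.

Lemma semistandard_column_sorted n lam T j : semistandard n lam T ->
  0 < j -> sorted ltn [seq T j r | r <- iota 1 (colLen lam j)].
Proof.
move=> HT j0; apply/(sortedP 0) => k; rewrite size_map size_iota => Hk.
rewrite !(nth_map 0) ?size_iota ?nth_iota //; try lia.
by apply: (semistandard_column HT); lia.
Qed.

Definition greedy_upto n lam T k : seq nat :=
  foldl (greedy_step lam T) (greedy_init n lam T)
    (flatten [seq [seq (j, i) | i <- rev (iota 1 (colLen lam j))]
             | j <- iota 2 k.-1]).

Lemma greedy_uptoS n lam T k : 0 < k ->
  greedy_upto n lam T k.+1 =
    foldl (greedy_step lam T) (greedy_upto n lam T k)
      [seq (k.+1, i) | i <- rev (iota 1 (colLen lam k.+1))].
Proof.
move=> k0; rewrite {1}/greedy_upto /=.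
have -> : iota 2 k = iota 2 k.-1 ++ [:: k.+1].
  by rewrite -{1}(prednK k0) -(addn1 k.-1) iotaD /=; congr (_ ++ [:: _]); lia.
by rewrite map_cat flatten_cat foldl_cat /= cats0.
Qed.

(** Third clause: a descent after the first [x.+1] letters needs a processed column of that length.
    The last clause also carries the order of the path ends, on which [greedy_column] relies. *)
Lemma greedy_upto_spec n lam T k :
  size lam = n -> semistandard n lam T -> 0 < k <= lam1 lam ->
  let p := greedy_upto n lam T k in
  [/\ perm_eq p (iota 1 n),
      take (colLen lam k) p = [seq T k r | r <- iota 1 (colLen lam k)],
      forall x, x.+1 < n -> (forall l, 0 < l <= k -> colLen lam l != x.+1) ->
        nth 0 p x < nth 0 p x.+1
    & forall l, 0 < l <= k ->
        sorted gtn (path_values lam T l k) /\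
        perm_eq (path_values lam T l k) (take (colLen lam l) p)].
Proof.
move=> szl HT /andP[k0].
have start j p : 0 < j ->
    take (colLen lam j) p = [seq T j r | r <- iota 1 (colLen lam j)] ->
    sorted gtn (path_values lam T j j) /\
    perm_eq (path_values lam T j j) (take (colLen lam j) p).
  move=> j0 ->; rewrite path_values_start perm_rev rev_sorted; split=> //.
  exact: semistandard_column_sorted HT j0.
elim: k k0 => // k IH _ lt_k; have [Ek|k_gt0] := posnP k.
  rewrite Ek /= /greedy_upto /= /greedy_init.
  set C := map _ _; set D := filter _ _.
  have szC : size C = colLen lam 1 by rewrite size_map size_iota.
  have HC : sorted ltn C by exact: semistandard_column_sorted HT _.
  have Hperm : perm_eq (C ++ D) (iota 1 n).
    apply: uniq_perm; last 1 first.
    - move=> v; rewrite mem_cat mem_filter; case: (boolP (v \in C)) => //= vC.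
      case/mapP: vC => r; rewrite !mem_iota => Hr ->.
      have [] := HT 1 r; first by rewrite /in_shape; lia.
      by move=> *; lia.
    - rewrite cat_uniq filter_uniq ?iota_uniq // andbT.
      rewrite (sorted_uniq ltn_trans ltnn HC) /=.
      by apply/hasPn => v; rewrite mem_filter => /andP[].
    - exact: iota_uniq.
  have Ht : take (colLen lam 1) (C ++ D) = C by rewrite -szC take_size_cat.
  split=> // [x lt_x /(_ 1 isT) ne|l Hl].
    have szCD : size (C ++ D) = n by rewrite (perm_size Hperm) size_iota.
    rewrite !nth_cat szC; case: (ltnP x (colLen lam 1)) => Hx.
      have -> : x.+1 < colLen lam 1 by lia.
      by apply: (sortedP 0 HC); rewrite szC; lia.
    have -> : x.+1 < colLen lam 1 = false by lia.
    have -> : x.+1 - colLen lam 1 = (x - colLen lam 1).+1 by lia.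
    have HD : sorted ltn D.
      by apply: sorted_filter; [exact: ltn_trans | exact: iota_ltn_sorted].
    by apply: (sortedP 0 HD); move: szCD; rewrite size_cat szC; lia.
  have -> : l = 1 by lia.
  exact: start.
have {IH} := IH k_gt0 (ltnW lt_k).
rewrite greedy_uptoS //; set p := greedy_upto _ _ _ k.
move=> [Hp Htk Hasc Hscan].
have le_c : colLen lam k.+1 <= colLen lam k by exact: colLen_mono.
have in_k r : 0 < r <= colLen lam k.+1 -> in_shape lam k r /\ in_shape lam k.+1 r.
  by rewrite /in_shape; lia.
have [] := @greedy_column n lam T k.+1 (colLen lam k.+1) p (leqnn _) _ _ _ _ Hp.
- by move=> r /in_k[H1 H2]; have [_ ->] := HT _ _ H1.
- by move=> r r' r0 Hr; apply: (semistandard_column HT) => //=; lia.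
- by move=> r r' r0 Hr; apply: (semistandard_column HT).
- by move=> r /in_k[_ H2]; have [] := HT _ _ H2.
- rewrite subnn /= cats0 -(take_takel _ le_c) Htk -map_take take_iota.
  by rewrite (minn_idPl le_c).
set p' := foldl _ _ _ => Hp' Htk' Hasc' Hcs; split=> // [x lt_x Hne|l Hl].
  have szp' : size p' = n by rewrite (perm_size Hp') size_iota.
  have nc := Hne k.+1; rewrite leqnn /= in nc; have {}nc := nc isT.
  (* Either [x] lies beyond the column, where ascents survive, or [x] and [x.+1] both lie inside it,
     since [x.+1] is not its length. *)
  case: (leqP (colLen lam k.+1) x) => Hx.
    by apply: Hasc' => //; apply: Hasc => // l Hl; apply: Hne; lia.
  have Hs := semistandard_column_sorted HT (ltn0Sn k).
  rewrite -(nth_take 0 (n0 := colLen lam k.+1)) //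
    -(nth_take 0 (n0 := colLen lam k.+1) (i := x.+1)); last lia.
  by rewrite Htk'; apply: (sortedP 0 Hs); rewrite size_map size_iota; lia.
have [->|nl] := eqVneq l k.+1; first exact: start.
have [|Hs Hperm] := Hscan l; first lia.
rewrite path_valuesS; last lia.
split.
  apply: colscan_sorted Hs => r Hr.
  by apply: (semistandard_column HT) => //; lia.
have le_cl : colLen lam k.+1 <= colLen lam l by apply: colLen_mono; lia.
(* The part of the prefix beyond the new column length supplies the cut [z] of [greedy_column]. *)
have E s : take (colLen lam l) s =
    take (colLen lam k.+1) s ++ take (colLen lam l - colLen lam k.+1) (drop (colLen lam k.+1) s).
  by rewrite -takeD subnKC.
by rewrite E Htk'; apply: Hcs => //; rewrite -E.
Qed.

(** * Recovering the permutation from its prefix sets *)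

Lemma filter_slice n p a b :
  perm_eq p (iota 1 n) -> a <= b <= n ->
  (forall k, a <= k -> k.+1 < b -> nth 0 p k < nth 0 p k.+1) ->
  [seq v <- iota 1 n | (v \in take b p) && (v \notin take a p)]
    = drop a (take b p).
Proof.
move=> Hp /andP[le_ab le_bn] Hasc.
have szp : size p = n by rewrite (perm_size Hp) size_iota.
have szb : size (take b p) = b by rewrite size_takel ?szp.
have Hu : uniq (take b p) by rewrite take_uniq // (perm_uniq Hp) iota_uniq.
apply: (irr_sorted_eq ltn_trans ltnn).
- by apply: sorted_filter; [exact: ltn_trans | exact: iota_ltn_sorted].
- apply/(sortedP 0) => k; rewrite size_drop szb => Hk.
  by rewrite !nth_drop !nth_take; try lia; rewrite addnS; apply: Hasc; lia.
move=> v; rewrite mem_filter -(perm_mem Hp) -(take_takel p le_ab).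
move: Hu; rewrite -{1 2}(cat_take_drop a (take b p)) cat_uniq mem_cat.
case/and3P=> _ /hasPn Hn _.
have [vd|vd] := boolP (v \in drop a (take b p)).
  rewrite (negbTE (Hn v vd)) /=.
  by apply: (mem_take (n0 := b)); apply: mem_drop vd.
by case: (v \in take a _).
Qed.

(** The [if] encodes [zeta_0 = 0], as [zs] is indexed from 0. Each block increases because no member
    of [zs] lies strictly between consecutive ones; the slices then concatenate to a prefix. *)
Lemma flatten_slices n p zs (P : nat -> pred nat) :
  perm_eq p (iota 1 n) -> sorted ltn zs -> (forall z, z \in zs -> z <= n) ->
  (forall k, k.+1 < n -> k.+1 \notin zs -> nth 0 p k < nth 0 p k.+1) ->
  (forall h v, h < size zs ->
     P h v = (v \in take (nth 0 zs h) p) &&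
             (v \notin take (if h is h'.+1 then nth 0 zs h' else 0) p)) ->
  forall k, k <= size zs ->
  flatten [seq [seq v <- iota 1 n | P h v] | h <- iota 0 k] =
    take (if k is k'.+1 then nth 0 zs k' else 0) p.
Proof.
move=> Hp Hzs zs_n Hasc HP; elim=> [|k IH] lt_k; first by rewrite take0.
rewrite -[in iota 0 _](addn1 k) iotaD map_cat flatten_cat (IH (ltnW lt_k)) /= cats0.
rewrite (eq_filter (fun v => HP k v lt_k)).
set a := (if k is _.+1 then _ else _).
have le_n : nth 0 zs k <= n by apply: zs_n; apply: mem_nth.
have lt_nth x y : x < y -> y < size zs -> nth 0 zs x < nth 0 zs y.
  by move=> lt_xy lt_y; apply: (sorted_ltn_nth ltn_trans 0 Hzs); rewrite ?inE //; lia.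
have le_a : a <= nth 0 zs k.
  by rewrite /a; case: (k) lt_k => // k' lt_k; apply/ltnW/lt_nth.
rewrite (filter_slice Hp) ?le_a //; first by rewrite -(take_takel p le_a) cat_take_drop.
move=> x le_ax lt_x; apply: Hasc; first lia.
apply/(nthP 0) => -[y lt_y Ey].
have [lt_yk|le_ky] := ltnP y k; last first.
  have [E|ne] := eqVneq k y; first by move: lt_x; rewrite E Ey ltnn.
  have := lt_nth k y; rewrite ltn_neqAle ne le_ky Ey => /(_ isT lt_y); lia.
suff : nth 0 zs y <= a by rewrite Ey ltnNge le_ax.
rewrite /a; case: (k) lt_k lt_yk => // k' lt_k lt_yk.
have [->//|ne] := eqVneq y k'; apply/ltnW/lt_nth; lia.
Qed.

Theorem theorem5p4 (n : nat) (lam : seq nat) (T : nat -> nat -> nat) :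
  0 < n -> is_partition n lam -> semistandard n lam T ->
  greedy_perm n lam T = sigma_perm n lam T.
Proof.
move=> _ [szl Hsort _ Hpos] HT.
have l1 : 0 < lam1 lam.
  case: lam Hsort Hpos {szl HT} => //= x s Hs; rewrite lt0n.
  case: eqP => //= x0 /hasP[y ys y0]; have geq_tr : transitive geq by move=> u v w /=; lia.
  by have /allP/(_ y ys) /= := order_path_min geq_tr Hs; lia.
have Hl1 : 0 < lam1 lam <= lam1 lam by rewrite l1 leqnn.
have [] := greedy_upto_spec szl HT Hl1.
rewrite -[greedy_upto _ _ _ _]/(greedy_perm n lam T).
set p := greedy_perm n lam T => Hp _ Hasc Hscan.
have Hval l v : 0 < l <= lam1 lam ->
    has (fun r => scanT lam T l r == v) (iota 1 (colLen lam l)) =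
    (v \in take (colLen lam l) p).
  by move=> /Hscan[_ Hperm]; rewrite has_scanT (perm_mem Hperm).
have mem_zs z : (z \in zetas lam) = (z \in [seq colLen lam j | j <- iota 1 (lam1 lam)]).
  by rewrite mem_sort mem_undup.
have Hzs : sorted ltn (zetas lam).
  rewrite ltn_sorted_uniq_leq sort_uniq undup_uniq /=.
  by apply: sort_sorted; exact: leq_total.
(* All columns of length [z] in the scanning tableau carry the same values, the first [z] letters of
   [p], so any of them may be the witness; [z = 0] covers [zeta_0]. *)
have Hcols z v : z \in zetas lam \/ z = 0 ->
    in_cols_of_len lam (scanT lam T) z v = (v \in take z p).
  move=> Hz; apply/hasP/idP => [[l]|Hv].
    by rewrite mem_iota => Hl /andP[/eqP <-]; rewrite Hval //; lia.
  case: Hz Hv => [|->]; last by rewrite take0.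
  rewrite mem_zs => /mapP[l]; rewrite mem_iota => Hl -> Hv.
  by exists l; rewrite ?mem_iota // eqxx Hval //; lia.
have zs_n z : z \in zetas lam -> z <= n.
  by rewrite mem_zs => /mapP[l _ ->]; rewrite -szl count_size.
have Hasc' k : k.+1 < n -> k.+1 \notin zetas lam -> nth 0 p k < nth 0 p k.+1.
  move=> lt_k Hk; apply: Hasc => // l Hl; apply: contraNneq Hk => <-.
  by rewrite mem_zs map_f // mem_iota; lia.
have c1_zs : colLen lam 1 \in zetas lam by rewrite mem_zs map_f // mem_iota; lia.
have c1_max z : z \in zetas lam -> z <= colLen lam 1.
  by rewrite mem_zs => /mapP[l]; rewrite mem_iota => Hl ->; apply: colLen_mono; lia.
rewrite /sigma_perm (flatten_slices Hp Hzs zs_n Hasc') //; last first.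
  move=> h v lt_h; rewrite !Hcols //; last by left; apply: mem_nth.
  by case: h lt_h => [|h] lt_h; [right | left; apply: mem_nth; exact: ltnW].
have -> : (if size (zetas lam) is k'.+1 then nth 0 (zetas lam) k' else 0) = colLen lam 1.
  move: c1_zs c1_max Hzs; case: (zetas lam) => // z zs c1_zs c1_max Hzs /=.
  apply/eqP; rewrite eqn_leq c1_max ?mem_nth //=.
  case/(nthP 0): c1_zs => y lt_y <-.
  have [->//|ne] := eqVneq y (size zs).
  apply/ltnW/(sorted_ltn_nth ltn_trans 0 Hzs); rewrite ?inE //= in lt_y *; lia.
rewrite -[LHS](cat_take_drop (colLen lam 1)); congr (_ ++ _).
have szp : size p = n by rewrite (perm_size Hp) size_iota.
have c1_n := zs_n _ c1_zs.
(* The final block is the slice from the first column length to [n]; no column is longer, so it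
   increases. *)
transitivity (drop (colLen lam 1) (take n p)); first by rewrite take_oversize ?szp.
rewrite -(filter_slice Hp) ?c1_n ?leqnn // => [|k le_k lt_k].
  apply: eq_in_filter => v; rewrite -(perm_mem Hp) Hval //.
  by rewrite take_oversize ?szp // => ->.
apply: Hasc' => //; apply/negP => /c1_max; lia.
Qed.
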